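(* Let $H$ be a finite-dimensional Hopf algebra over any field $\Bbbk$. Then the sequence $\{\nu_n(H)\}_{n\ge 1}$ of indicators of $H$ is linearly recursive, and the degree of its minimal polynomial is at most $(\dim H)^2$. Moreover, the minimal polynomial $p_H$ of this sequence is a gauge invariant: if $H'$ is a Hopf algebra over $\Bbbk$ gauge equivalent to $H$, then $p_{H'}=p_H$.
   Context: For a finite-dimensional Hopf algebra $H$ over $\Bbbk$ with comultiplication $\Delta$, counit $\varepsilon$ and antipode $S$: let $\Delta^{(1)}=\mathrm{id}$, $\Delta^{(n+1)}=(\mathrm{id}\otimes\Delta^{(n)})\circ\Delta$, and let $m^{(n)}:H^{\otimes n}\to H$ be the $n$-fold multiplication ($m^{(1)}=\mathrm{id}$). The $n$-th Sweedler power is $P_n(h)=m^{(n)}\circ\Delta^{(n)}(h)$ for $n\ge1$, and $P_0(h)=\varepsilon(h)1$. The $n$-th indicator of $H$ ($n\ge 1$) is $\nu_n(H)=\operatorname{Tr}(S\circ P_{n-1})$. A sequence $\{a_n\}_{n\ge1}$ in $\Bbbk$ is linearly recursive if it satisfies some non-zero polynomial $f(x)=f_0+f_1x+\cdots+f_mx^m\in\Bbbk[x]$, meaning $f_0a_n+f_1a_{n+1}+\cdots+f_ma_{n+m}=0$ for all $n\ge1$. Its minimal polynomial is the monic polynomial of least degree satisfied by the sequence. A gauge transformation of $H$ is an invertible $F\in H\otimes H$ with $(\varepsilon\otimes\mathrm{id})(F)=(\mathrm{id}\otimes\varepsilon)(F)=1$. It is a 2-cocycle if $(1\otimes F)(\mathrm{id}\otimes\Delta)(F)=(F\otimes1)(\Delta\otimes\mathrm{id})(F)$.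 For a 2-cocycle $F$, the twist $H^F$ is the Hopf algebra with the same algebra structure and counit as $H$ and with comultiplication $\Delta_F(h)=F\Delta(h)F^{-1}$. Hopf algebras $H,H'$ over $\Bbbk$ are gauge equivalent if there is a 2-cocycle $F$ of $H$ such that $H'\cong H^F$ as bialgebras. *)

(* Defs.v *)
From HB Require Import structures.
From mathcomp Require Import all_boot all_order all_algebra all_field.

Set Implicit Arguments.
Unset Strict Implicit.
Unset Printing Implicit Defensive.

Import GRing.Theory.
Local Open Scope ring_scope.

(* An element of U (x) V is represented by its matrix of coordinates in the
   basis (e_i (x) e'_j), where (e_i) and (e'_j) are the library's bases
   [vbasis fullv] of U and V. [tlift_pure] and [tensor_ext] below give the
   universal property of the tensor product. *)
Definition tensor (K : fieldType) (U V : vectType K) : Type :=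
  'M[K]_(\dim {:U}, \dim {:V}).

HB.instance Definition _ (K : fieldType) (U V : vectType K) :=
  Vector.copy (tensor U V) 'M[K]_(\dim {:U}, \dim {:V}).

Definition pure (K : fieldType) (U V : vectType K) (u : U) (v : V) :
    tensor U V :=
  \matrix_(i, j) (coord (vbasis {:U}) i u * coord (vbasis {:V}) j v).

Notation "u ⊗ v" := (pure u v) (at level 40, left associativity) : ring_scope.

Definition tlift_fun (K : fieldType) (U V W : vectType K) (f : U -> V -> W)
    (t : tensor U V) : W :=
  \sum_i \sum_j t i j *: f (vbasis {:U})`_i (vbasis {:V})`_j.

(* The linear map on U (x) V induced by f; it sends u (x) v to f u v as soon as
   f is bilinear. *)
Definition tlift (K : fieldType) (U V W : vectType K) (f : U -> V -> W) :
    'Hom(tensor U V, W) :=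
  linfun (tlift_fun f).

Section TensorTheory.
Variable K : fieldType.
Implicit Types U V W : vectType K.

Lemma tlift_fun_linear U V W (f : U -> V -> W) : linear (tlift_fun f).
Proof.
move=> a s t; rewrite /tlift_fun scaler_sumr -big_split; apply: eq_bigr => i _.
rewrite scaler_sumr -big_split; apply: eq_bigr => j _ /=.
by rewrite !mxE scalerDl scalerA.
Qed.
HB.instance Definition _ U V W (f : U -> V -> W) :=
  GRing.isSemilinear.Build K (tensor U V) W _ (tlift_fun f)
    (GRing.semilinear_linear (tlift_fun_linear f)).

Lemma tliftE U V W (f : U -> V -> W) t : tlift f t = tlift_fun f t.
Proof. exact: lfunE. Qed.

Lemma pure_linear_l U V (v : V) : linear ((@pure K U V)^~ v).
Proof.
by move=> a x y; apply/matrixP => i j; rewrite !mxE linearP mulrDl mulrA.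
Qed.

Lemma pure_linear_r U V (u : U) : linear (@pure K U V u).
Proof.
move=> a x y; apply/matrixP => i j.
by rewrite !mxE linearP mulrDr mulrCA.
Qed.

Lemma pure0l U V (v : V) : (0 : U) ⊗ v = 0.
Proof. by apply/matrixP => i j; rewrite !mxE linear0 mul0r. Qed.

Lemma pureZl U V a (u : U) (v : V) : (a *: u) ⊗ v = a *: (u ⊗ v).
Proof. by have := pure_linear_l v a u 0; rewrite !addr0 pure0l addr0. Qed.

Lemma pureDl U V (u u' : U) (v : V) : (u + u') ⊗ v = u ⊗ v + u' ⊗ v.
Proof. by have := pure_linear_l v 1 u u'; rewrite !scale1r. Qed.

Lemma tensor_basis U V (t : tensor U V) :
  t = \sum_i \sum_j t i j *: ((vbasis {:U})`_i ⊗ (vbasis {:V})`_j).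
Proof.
apply/matrixP => k l; rewrite summxE (bigD1 k) //= summxE (bigD1 l) //= !mxE.
have dc (X : vectType K) (i j : 'I_(\dim {:X})) :
    coord (vbasis {:X}) i (vbasis {:X})`_j = (i == j)%:R.
  by rewrite coord_free ?(basis_free (vbasisP _)) // eq_sym.
rewrite !dc !eqxx !mulr1 big1 ?addr0 => [|j /negPf nj]; last first.
  by rewrite !mxE !dc (eq_sym l) nj !mulr0.
rewrite big1 ?addr0 // => i /negPf ni; rewrite summxE big1 // => j _.
by rewrite !mxE !dc (eq_sym k) ni mul0r mulr0.
Qed.

Lemma tensor_ind U V (P : tensor U V -> Prop) :
  (forall u v, P (u ⊗ v)) -> (forall s t, P s -> P t -> P (s + t)) ->
  forall t, P t.
Proof.
move=> Pp PD t; have P0 : P 0 by rewrite -(pure0l U (0 : V)).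
rewrite [t]tensor_basis; apply: (big_ind P) => // i _.
by apply: (big_ind P) => // j _; rewrite -pureZl.
Qed.

Lemma tensor_ext U V W (f g : 'Hom(tensor U V, W)) :
  (forall u v, f (u ⊗ v) = g (u ⊗ v)) -> f = g.
Proof.
move=> fg; apply/lfunP; elim/tensor_ind=> [u v|s t fs ft]; first exact: fg.
by rewrite !linearD /= fs ft.
Qed.

Lemma tlift_pure U V W (f : U -> V -> W) u v :
  (forall x, linear (f x)) -> (forall y, linear (f^~ y)) ->
  tlift f (u ⊗ v) = f u v.
Proof.
move=> fl fr; rewrite tliftE /tlift_fun.
have lin_sum (X Y : vectType K) (g : X -> Y) (n : nat) c (x : 'I_n -> X) :
    linear g -> g (\sum_i c i *: x i) = \sum_i c i *: g (x i).
  move=> gl; have g0 : g 0 = 0.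
    by have := gl (-1) 0 0; rewrite scaler0 addr0 scaleN1r addNr.
  by apply: (big_rec2 (fun a b => g a = b)) => // i a b _ <-; rewrite gl.
rewrite {2}(coord_vbasis (memvf u)) {2}(coord_vbasis (memvf v)).
rewrite (lin_sum _ _ (f^~ _)) //.
apply: eq_bigr => i _; rewrite (lin_sum _ _ (f _)) // scaler_sumr.
by apply: eq_bigr => j _; rewrite mxE scalerA.
Qed.

End TensorTheory.

Definition tmap (K : fieldType) (U U' V V' : vectType K)
    (f : 'Hom(U, U')) (g : 'Hom(V, V')) : 'Hom(tensor U V, tensor U' V') :=
  tlift (fun u v => f u ⊗ g v).

Definition tassoc (K : fieldType) (U V W : vectType K) :
    'Hom(tensor (tensor U V) W, tensor U (tensor V W)) :=
  tlift (fun (t : tensor U V) (w : W) =>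
    tlift (fun (u : U) (v : V) => (u ⊗ (v ⊗ w) : tensor U (tensor V W))) t).

(* The canonical isomorphisms K (x) V ~ V and V (x) K ~ V. *)
Definition tunitl (K : fieldType) (V : vectType K) : 'Hom(tensor K^o V, V) :=
  tlift (fun (c : K^o) (v : V) => (c : K) *: v).

Definition tunitr (K : fieldType) (V : vectType K) : 'Hom(tensor V K^o, V) :=
  tlift (fun (v : V) (c : K^o) => (c : K) *: v).

Section TensorAlgebra.
Variables (K : fieldType) (A B : falgType K).
Implicit Types r s t : tensor A B.

Definition tensor_mul s t : tensor A B :=
  tlift (fun (a : A) (b : B) =>
    tlift (fun (a' : A) (b' : B) => ((a * a') ⊗ (b * b') : tensor A B)) t) s.

Lemma tensor_mul_linear_l t : linear (tensor_mul^~ t).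
Proof. by move=> a x y; rewrite /tensor_mul linearP. Qed.

Lemma tensor_mul_linear_r s : linear (tensor_mul s).
Proof.
move=> a x y; rewrite /tensor_mul !tliftE /tlift_fun.
rewrite scaler_sumr -big_split; apply: eq_bigr => i _.
rewrite scaler_sumr -big_split; apply: eq_bigr => j _ /=.
by rewrite linearP scalerDr !scalerA mulrC.
Qed.

Lemma tensor_mulDl : left_distributive tensor_mul +%R.
Proof.
by move=> x y t; have := tensor_mul_linear_l t 1 x y; rewrite !scale1r.
Qed.

Lemma tensor_mulDr : right_distributive tensor_mul +%R.
Proof.
by move=> s x y; have := tensor_mul_linear_r s 1 x y; rewrite !scale1r.
Qed.

Lemma tensor_mul_pure (a a' : A) (b b' : B) :
  tensor_mul (a ⊗ b) (a' ⊗ b') = (a * a') ⊗ (b * b').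
Proof.
have in_pure (x : A) (y : B) :
    tlift (fun (c : A) (d : B) => ((x * c) ⊗ (y * d) : tensor A B)) (a' ⊗ b')
    = (x * a') ⊗ (y * b').
  rewrite tlift_pure // => [u | v] c z w; rewrite mulrDr -scalerAr.
    exact: pure_linear_r.
  exact: pure_linear_l.
rewrite /tensor_mul tlift_pure => [|x|y] //.
- move=> c z w; rewrite !in_pure mulrDl -scalerAl; exact: pure_linear_r.
- move=> c z w; rewrite !in_pure mulrDl -scalerAl; exact: pure_linear_l.
Qed.

Lemma tensor_mulA : associative tensor_mul.
Proof.
move=> r s t; elim/tensor_ind: r => [a b|x y Hx Hy]; last first.
  by rewrite !tensor_mulDl Hx Hy.
elim/tensor_ind: s => [c d|x y Hx Hy]; last first.
  by rewrite !(tensor_mulDl, tensor_mulDr) Hx Hy.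
elim/tensor_ind: t => [e f|x y Hx Hy]; last by rewrite !tensor_mulDr Hx Hy.
by rewrite !tensor_mul_pure !mulrA.
Qed.

Lemma tensor_mul1l : left_id (1 ⊗ 1) tensor_mul.
Proof.
elim/tensor_ind=> [a b|x y Hx Hy]; last by rewrite tensor_mulDr Hx Hy.
by rewrite tensor_mul_pure !mul1r.
Qed.

Lemma tensor_mul1r : right_id (1 ⊗ 1) tensor_mul.
Proof.
elim/tensor_ind=> [a b|x y Hx Hy]; last by rewrite tensor_mulDl Hx Hy.
by rewrite tensor_mul_pure !mulr1.
Qed.

Lemma tensor_one_neq0 : (1 : A) ⊗ (1 : B) != 0.
Proof.
have coord1 (C : falgType K) : exists i, coord (vbasis {:C}) i 1 != 0.
  apply/existsP; apply: contraNT (oner_neq0 C); rewrite negb_exists.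
  move=> /forallP c0; rewrite (coord_vbasis (memvf (1 : C))) big1 // => i _.
  by have := c0 i; rewrite negbK => /eqP->; rewrite scale0r.
have [i ci] := coord1 A; have [j cj] := coord1 B.
apply: contraNneq (mulf_neq0 ci cj) => /matrixP/(_ i j).
by rewrite !mxE => ->.
Qed.

HB.instance Definition _ := GRing.Zmodule_isNzRing.Build (tensor A B)
  tensor_mulA tensor_mul1l tensor_mul1r tensor_mulDl tensor_mulDr
  tensor_one_neq0.

Lemma tensor_scalerAl (c : K) s t : c *: (s * t) = (c *: s) * t.
Proof.
have := tensor_mul_linear_l t c s 0; rewrite -[tensor_mul 0 t]/(0 * t).
by rewrite mul0r !addr0 => /esym.
Qed.

Lemma tensor_scalerAr (c : K) s t : c *: (s * t) = s * (c *: t).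
Proof.
have := tensor_mul_linear_r s c t 0; rewrite -[tensor_mul s 0]/(s * 0).
by rewrite mulr0 !addr0 => /esym.
Qed.

HB.instance Definition _ :=
  GRing.Lmodule_isLalgebra.Build K (tensor A B) tensor_scalerAl.
HB.instance Definition _ :=
  GRing.Lalgebra_isAlgebra.Build K (tensor A B) tensor_scalerAr.
HB.instance Definition _ := Algebra_isFalgebra.Build K (tensor A B).

End TensorAlgebra.

Definition tmult (K : fieldType) (A : falgType K) : 'Hom(tensor A A, A) :=
  tlift (fun x y : A => x * y).

Definition scalar_fun (K : fieldType) (A : falgType K) (c : K^o) : A :=
  (c : K)%:A.

Lemma scalar_fun_linear (K : fieldType) (A : falgType K) :
  linear (scalar_fun A).
Proof. by move=> a x y; rewrite /scalar_fun scalerDl scalerA. Qed.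
HB.instance Definition _ (K : fieldType) (A : falgType K) :=
  GRing.isSemilinear.Build K K^o A _ (scalar_fun A)
    (GRing.semilinear_linear (@scalar_fun_linear K A)).

Definition scalar_lfun (K : fieldType) (A : falgType K) : 'Hom(K^o, A) :=
  linfun (scalar_fun A).

Section TensorMorphisms.
Variable K : fieldType.

Lemma tmapE (U U' V V' : vectType K) (f : 'Hom(U, U')) (g : 'Hom(V, V')) u v :
  tmap f g (u ⊗ v) = f u ⊗ g v.
Proof.
rewrite /tmap tlift_pure // => x a y z; rewrite linearP.
  exact: pure_linear_r.
exact: pure_linear_l.
Qed.

Lemma tassocE (U V W : vectType K) (u : U) (v : V) (w : W) :
  tassoc U V W ((u ⊗ v) ⊗ w) = u ⊗ (v ⊗ w).
Proof.
have in_pure (z : W) :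
    tlift (fun x y => (x ⊗ (y ⊗ z) : tensor U (tensor V W))) (u ⊗ v)
    = u ⊗ (v ⊗ z).
  rewrite tlift_pure // => x a y t; last exact: pure_linear_l.
  by rewrite pure_linear_l pure_linear_r.
rewrite /tassoc tlift_pure ?in_pure // => [t a x y|y a s t]; last first.
  by rewrite linearP.
rewrite !tliftE /tlift_fun scaler_sumr -big_split; apply: eq_bigr => i _.
rewrite scaler_sumr -big_split; apply: eq_bigr => j _ /=.
by rewrite !pure_linear_r scalerDr !scalerA mulrC.
Qed.

Lemma tunitlE (V : vectType K) (c : K^o) (v : V) :
  tunitl V (c ⊗ v) = (c : K) *: v.
Proof.
rewrite /tunitl tlift_pure // => [x|y] a z t; last by rewrite scalerDl scalerA.
by rewrite scalerDr !scalerA mulrC.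
Qed.

Lemma tunitrE (V : vectType K) (v : V) (c : K^o) :
  tunitr V (v ⊗ c) = (c : K) *: v.
Proof.
rewrite /tunitr tlift_pure // => [x|y] a z t; first by rewrite scalerDl scalerA.
by rewrite scalerDr !scalerA mulrC.
Qed.

Lemma tmultE (A : falgType K) (x y : A) : tmult A (x ⊗ y) = x * y.
Proof.
rewrite /tmult tlift_pure // => [u|v] a z t.
  by rewrite mulrDr -scalerAr.
by rewrite mulrDl -scalerAl.
Qed.

Lemma pureM (A B : falgType K) (a a' : A) (b b' : B) :
  (a ⊗ b) * (a' ⊗ b') = (a * a') ⊗ (b * b').
Proof. exact: tensor_mul_pure. Qed.

Lemma pure1 (A B : falgType K) : (1 : A) ⊗ (1 : B) = 1.
Proof. by []. Qed.

Lemma ahom_tensor (A B C : falgType K) (f : 'Hom(tensor A B, C)) :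
  f (1 ⊗ 1) = 1 ->
  (forall a b a' b',
     f ((a ⊗ b) * (a' ⊗ b')) = f (a ⊗ b) * f (a' ⊗ b')) ->
  ahom_in {:tensor A B} f.
Proof.
move=> f1 fM; apply/ahom_inP; split=> // + + _ _.
elim/tensor_ind=> [a b|s t Hs Ht] x; last first.
  by rewrite mulrDl !linearD /= Hs Ht mulrDl.
elim/tensor_ind: x => [a' b'|s t Hs Ht]; last first.
  by rewrite mulrDr !linearD /= Hs Ht mulrDr.
exact: fM.
Qed.

Lemma tmap_is_ahom (A A' B B' : falgType K)
    (f : 'AHom(A, A')) (g : 'AHom(B, B')) :
  ahom_in {:tensor A B} (tmap f g).
Proof.
apply: ahom_tensor => [|a b a' b']; first by rewrite tmapE !rmorph1.
by rewrite pureM !tmapE pureM !rmorphM.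
Qed.
Canonical tmap_ahom (A A' B B' : falgType K)
  (f : 'AHom(A, A')) (g : 'AHom(B, B')) := AHom (tmap_is_ahom f g).

Lemma tassoc_is_ahom (A B C : falgType K) :
  ahom_in {:tensor (tensor A B) C} (tassoc A B C).
Proof.
apply: ahom_tensor => [|s c s' c']; first by rewrite -pure1 tassocE.
elim/tensor_ind: s => [a b|x y Hx Hy]; last first.
  by rewrite pureDl mulrDl !linearD /= Hx Hy mulrDl.
elim/tensor_ind: s' => [a' b'|x y Hx Hy]; last first.
  by rewrite pureDl mulrDr !linearD /= Hx Hy mulrDr.
by rewrite !(pureM, tassocE).
Qed.
Canonical tassoc_ahom (A B C : falgType K) := AHom (tassoc_is_ahom A B C).

Lemma tunitl_is_ahom (A : falgType K) : ahom_in {:tensor K^o A} (tunitl A).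
Proof.
apply: ahom_tensor => [|a b a' b']; first by rewrite tunitlE scale1r.
by rewrite pureM !tunitlE -scalerAl -scalerAr scalerA.
Qed.
Canonical tunitl_ahom (A : falgType K) := AHom (tunitl_is_ahom A).

Lemma tunitr_is_ahom (A : falgType K) : ahom_in {:tensor A K^o} (tunitr A).
Proof.
apply: ahom_tensor => [|a b a' b']; first by rewrite tunitrE scale1r.
by rewrite pureM !tunitrE -scalerAl -scalerAr scalerA.
Qed.
Canonical tunitr_ahom (A : falgType K) := AHom (tunitr_is_ahom A).

End TensorMorphisms.

HB.mixin Record isBialgebra (K : fieldType) H of Falgebra K H := {
  comul : 'AHom(H, tensor H H);
  counit : 'AHom(H, K^o);
  coassoc : forall h : H,
    tassoc H H H (tmap comul \1 (comul h)) = tmap \1 comul (comul h);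
  counitl : forall h : H, tunitl H (tmap counit \1 (comul h)) = h;
  counitr : forall h : H, tunitr H (tmap \1 counit (comul h)) = h
}.

#[short(type="bialgType")]
HB.structure Definition Bialgebra (K : fieldType) :=
  {H of isBialgebra K H & Falgebra K H}.

HB.mixin Record isHopfAlgebra (K : fieldType) H of Bialgebra K H := {
  antipode : 'End(H);
  antipodel : forall h : H,
    tmult H (tmap antipode \1 (comul h)) = (counit h : K)%:A;
  antipoder : forall h : H,
    tmult H (tmap \1 antipode (comul h)) = (counit h : K)%:A
}.

#[short(type="hopfAlgType")]
HB.structure Definition HopfAlgebra (K : fieldType) :=
  {H of isHopfAlgebra K H & Bialgebra K H}.

Section Indicators.
Variables (K : fieldType) (H : hopfAlgType K).

(* [tpow n] is the (n+1)-fold tensor power of H, [iter_comul n] is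
   Delta^(n+1) and [iter_mult n] is m^(n+1). *)
Fixpoint tpow (n : nat) : vectType K :=
  if n is n'.+1 then tensor H (tpow n') else H.

Fixpoint iter_comul (n : nat) : 'Hom(H, tpow n) :=
  if n is n'.+1 return 'Hom(H, tpow n)
  then (tmap \1 (iter_comul n') \o comul)%VF else \1%VF.

Fixpoint iter_mult (n : nat) : 'Hom(tpow n, H) :=
  if n is n'.+1 return 'Hom(tpow n, H)
  then (tmult H \o tmap \1 (iter_mult n'))%VF else \1%VF.

Definition sweedler_power (n : nat) : 'End(H) :=
  if n is n'.+1 then (iter_mult n' \o iter_comul n')%VF
  else (scalar_lfun H \o counit)%VF.

Lemma sweedler_power0 h : sweedler_power 0 h = (counit h : K)%:A.
Proof. by rewrite comp_lfunE lfunE. Qed.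

Lemma sweedler_power1 h : sweedler_power 1 h = h.
Proof. by rewrite comp_lfunE !id_lfunE. Qed.

Definition lfun_trace (f : 'End(H)) : K :=
  \tr (passmx.mxof (vbasis {:H}) (vbasis {:H}) f).

(* Only the values at n >= 1 are meaningful. *)
Definition indicator (n : nat) : K :=
  lfun_trace (antipode \o sweedler_power n.-1)%VF.

End Indicators.

(* The sequences are indexed by n >= 1: the value at 0 is never used. *)

Definition satisfies (K : fieldType) (a : nat -> K) (f : {poly K}) : Prop :=
  forall n : nat, (1 <= n)%N -> \sum_(i < size f) f`_i * a (n + i)%N = 0.

Definition linearly_recursive (K : fieldType) (a : nat -> K) : Prop :=
  exists2 f : {poly K}, f != 0 & satisfies a f.

Definition is_minimal_poly (K : fieldType) (a : nat -> K) (p : {poly K}) :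
    Prop :=
  [/\ p \is monic, satisfies a p &
      forall q : {poly K}, q \is monic -> satisfies a q ->
        (size p <= size q)%N].

Section Twist.
Variables (K : fieldType) (H : bialgType K).

Definition gauge_transformation (F : tensor H H) : Prop :=
  [/\ F \is a GRing.unit,
      tunitl H (tmap counit \1 F) = 1 &
      tunitr H (tmap \1 counit F) = 1].

(* The two sides of the cocycle identity live in the two bracketings of the
   threefold tensor power, which are identified along [tassoc]. *)
Definition two_cocycle (F : tensor H H) : Prop :=
  gauge_transformation F /\
  ((1 : H) ⊗ F) * tmap \1 comul F =
    tassoc H H H ((F ⊗ (1 : H)) * tmap comul \1 F).

Definition twist_comul (F : tensor H H) : 'Hom(H, tensor H H) :=
  (amulr (F^-1)%R \o amull F \o comul)%VF.

Lemma twist_comulE F h : twist_comul F h = F * comul h * F^-1.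
Proof. by rewrite !comp_lfunE !lfunE. Qed.

Lemma twist_comul_is_ahom F (cF : two_cocycle F) :
  ahom_in {:H} (twist_comul F).
Proof.
have [[uF _ _] _] := cF; apply/ahom_inP; split=> [x y _ _|].
  by rewrite !twist_comulE rmorphM /= !mulrA mulrVK.
by rewrite twist_comulE rmorph1 mulr1 divrr.
Qed.
Definition twist_comul_ahom F (cF : two_cocycle F) : 'AHom(H, tensor H H) :=
  AHom (twist_comul_is_ahom cF).

Lemma tmap_twistl F x :
  tmap (twist_comul F) \1 x =
    (F ⊗ (1 : H)) * tmap comul \1 x * (F^-1 ⊗ (1 : H)).
Proof.
elim/tensor_ind: x => [a b|s t Hs Ht]; last first.
  by rewrite !linearD /= Hs Ht mulrDr mulrDl.
by rewrite !tmapE !pureM twist_comulE mul1r mulr1.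
Qed.

Lemma tmap_twistr F x :
  tmap \1 (twist_comul F) x =
    ((1 : H) ⊗ F) * tmap \1 comul x * ((1 : H) ⊗ F^-1).
Proof.
elim/tensor_ind: x => [a b|s t Hs Ht]; last first.
  by rewrite !linearD /= Hs Ht mulrDr mulrDl.
by rewrite !tmapE !pureM twist_comulE mul1r mulr1.
Qed.

Lemma ahom_inv (A B : falgType K) (f : 'AHom(A, B)) x :
  x \is a GRing.unit -> f x * f x^-1 = 1.
Proof. by move=> ux; rewrite -rmorphM mulrV // rmorph1. Qed.

Lemma twist_coassoc F (cF : two_cocycle F) h :
  tassoc H H H (tmap (twist_comul F) \1 (twist_comul F h)) =
    tmap \1 (twist_comul F) (twist_comul F h).
Proof.
have [[uF _ _] eF] := cF; rewrite tmap_twistl tmap_twistr !twist_comulE.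
set T := tassoc H H H.
have -> : (F ⊗ (1 : H)) * tmap comul \1 (F * comul h * F^-1) * (F^-1 ⊗ 1)
    = ((F ⊗ (1 : H)) * tmap comul \1 F) * tmap comul \1 (comul h) *
      (tmap comul \1 F^-1 * (F^-1 ⊗ 1)).
  by rewrite !rmorphM /= !mulrA.
have -> : ((1 : H) ⊗ F) * tmap \1 comul (F * comul h * F^-1) * (1 ⊗ F^-1)
    = (((1 : H) ⊗ F) * tmap \1 comul F) * tmap \1 comul (comul h) *
      (tmap \1 comul F^-1 * (1 ⊗ F^-1)).
  by rewrite !rmorphM /= !mulrA.
rewrite eF -coassoc (rmorphM T) (rmorphM T); congr (_ * _).
set X := (F ⊗ (1 : H)) * tmap comul \1 F in eF *.
set Y := tmap comul \1 F^-1 * (F^-1 ⊗ 1).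
set Z := tmap \1 comul F^-1 * (1 ⊗ F^-1).
have XY : X * Y = 1.
  rewrite /X /Y mulrA -(mulrA (F ⊗ 1)) ahom_inv // mulr1 pureM mulr1.
  by rewrite mulrV.
have ZX : Z * T X = 1.
  rewrite -eF /Z mulrA -(mulrA _ (1 ⊗ F^-1)) pureM mulr1 mulVr // pure1 mulr1.
  by rewrite -rmorphM mulVr // rmorph1.
by rewrite -[LHS]mul1r -ZX -mulrA -(rmorphM T) XY rmorph1 mulr1.
Qed.

Lemma twist_counitl F (cF : two_cocycle F) h :
  tunitl H (tmap counit \1 (twist_comul F h)) = h.
Proof.
have [[uF eF _] _] := cF; rewrite twist_comulE !rmorphM /= eF mul1r counitl.
rewrite -[X in _ * X]mul1r -{1}eF -2!rmorphM mulrV //.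
by rewrite !rmorph1 mulr1.
Qed.

Lemma twist_counitr F (cF : two_cocycle F) h :
  tunitr H (tmap \1 counit (twist_comul F h)) = h.
Proof.
have [[uF _ eF] _] := cF; rewrite twist_comulE !rmorphM /= eF mul1r counitr.
rewrite -[X in _ * X]mul1r -{1}eF -2!rmorphM mulrV //.
by rewrite !rmorph1 mulr1.
Qed.

End Twist.

(* The twist is only built as a bialgebra: gauge equivalence is about
   isomorphism of bialgebras, and does not mention the antipode of H^F. *)
Definition twist (K : fieldType) (H : bialgType K) (F : tensor H H)
  (cF : two_cocycle F) : Type := H.

HB.instance Definition _ (K : fieldType) (H : bialgType K) (F : tensor H H)
    (cF : two_cocycle F) := Falgebra.copy (twist cF) H.
HB.instance Definition _ (K : fieldType) (H : bialgType K) (F : tensor H H)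
    (cF : two_cocycle F) :=
  isBialgebra.Build K (twist cF) (comul := twist_comul_ahom cF)
    (twist_coassoc cF) (twist_counitl cF) (twist_counitr cF).

Definition bialg_isom (K : fieldType) (A B : bialgType K) : Prop :=
  exists f : 'AHom(A, B),
    [/\ bijective f,
        forall a : A, comul (f a) = tmap f f (comul a) &
        forall a : A, counit (f a) = counit a].

Definition gauge_equivalent (K : fieldType) (H H' : hopfAlgType K) : Prop :=
  exists (F : tensor H H) (cF : two_cocycle F), bialg_isom H' (twist cF).

(* Main.v *)
Require Import Defs.
From HB Require Import structures.
From mathcomp Require Import all_boot all_order all_algebra all_field.
From Stdlib Require Import Classical_Prop.

Set Implicit Arguments.
Unset Strict Implicit.
Unset Printing Implicit Defensive.

Import GRing.Theory.
Local Open Scope ring_scope.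

(* The powers P_(n+1) = id * P_n are iterates of a linear operator on End(H), a
   space of dimension (dim H)^2, so P_0, ..., P_((dim H)^2) are dependent and
   the dependence propagates along the sequence.

   For gauge invariance, write D for the m-fold comultiplication and S for the
   antipode. As P_m and S commute, nu_(m+1)(H) is the trace of
     z_1 ⊗ ... ⊗ z_m |-> D(S z_1)(z_2 ⊗ ... ⊗ z_m ⊗ 1)    on H^(⊗m).
   For H^F one has D_F = F_m D F_m^-1 and S_F = u S(-) w, where u = Σ f S(g) and
   w = Σ S(f')g' with F = Σ f ⊗ g and F^-1 = Σ f' ⊗ g'. Conjugating by F_m and
   using the cocycle identity turns the operator of H^F into
     z |-> D(u) D(S z_1)(z_2 ⊗ ... ⊗ z_m ⊗ w).
   Moving left multiplication by D(f) around the trace multiplies the last slot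
   by S(f); returning to H, the trace is that of y |-> P_m(S(y S(f)w g)), and
   Σ S(f) w g = 1. *)

(** * Linear maps on tensor products, and traces *)

Section TensorMaps.
Variable K : fieldType.

Lemma pureDr (U V : vectType K) (u : U) (v v' : V) :
  u ⊗ (v + v') = u ⊗ v + u ⊗ v'.
Proof. by have := pure_linear_r u 1 v v'; rewrite !scale1r. Qed.

Definition pure_r (U V : vectType K) (v : V) (u : U) : tensor U V := u ⊗ v.

Lemma pure_r_linear (U V : vectType K) (v : V) : linear (@pure_r U V v).
Proof. exact: pure_linear_l. Qed.
HB.instance Definition _ (U V : vectType K) (v : V) :=
  GRing.isSemilinear.Build K U (tensor U V) _ (@pure_r U V v)
    (GRing.semilinear_linear (@pure_r_linear U V v)).

Definition tensr (U V : vectType K) (v : V) : 'Hom(U, tensor U V) :=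
  linfun (pure_r v).

Lemma tensrE (U V : vectType K) (u : U) (v : V) : tensr U v u = u ⊗ v.
Proof. exact: lfunE. Qed.

Definition pure_l (U V : vectType K) (u : U) (v : V) : tensor U V := u ⊗ v.

Lemma pure_l_linear (U V : vectType K) (u : U) : linear (@pure_l U V u).
Proof. exact: pure_linear_r. Qed.
HB.instance Definition _ (U V : vectType K) (u : U) :=
  GRing.isSemilinear.Build K V (tensor U V) _ (@pure_l U V u)
    (GRing.semilinear_linear (@pure_l_linear U V u)).

Definition tensl (U V : vectType K) (u : U) : 'Hom(V, tensor U V) :=
  linfun (pure_l u).

Lemma tenslE (U V : vectType K) (u : U) (v : V) : tensl V u v = u ⊗ v.
Proof. exact: lfunE. Qed.

Lemma tensl1_is_ahom (A B : falgType K) : ahom_in {:B} (tensl B (1 : A)).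
Proof.
by apply/ahom_inP; split=> [x y _ _|]; rewrite !tenslE // pureM mulr1.
Qed.
Definition tensl1 (A B : falgType K) := AHom (tensl1_is_ahom A B).

Lemma tensl1E (A B : falgType K) (b : B) : tensl1 A B b = 1 ⊗ b.
Proof. exact: tenslE. Qed.

Lemma tensr1_is_ahom (A B : falgType K) : ahom_in {:A} (tensr A (1 : B)).
Proof.
by apply/ahom_inP; split=> [x y _ _|]; rewrite !tensrE // pureM mulr1.
Qed.
Definition tensr1 (A B : falgType K) := AHom (tensr1_is_ahom A B).

Lemma tensr1E (A B : falgType K) (a : A) : tensr1 A B a = a ⊗ 1.
Proof. exact: tensrE. Qed.

Lemma tmap_comp (U U' U'' V V' V'' : vectType K)
    (f : 'Hom(U', U'')) (g : 'Hom(V', V''))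
    (f' : 'Hom(U, U')) (g' : 'Hom(V, V')) t :
  tmap f g (tmap f' g' t) = tmap (f \o f') (g \o g') t.
Proof.
elim/tensor_ind: t => [u v|s t Hs Ht]; first by rewrite !tmapE !comp_lfunE.
by rewrite !linearD /= Hs Ht.
Qed.

Lemma tmap1 (U V : vectType K) (t : tensor U V) : tmap \1 \1 t = t.
Proof.
elim/tensor_ind: t => [u v|s t Hs Ht]; first by rewrite !tmapE !id_lfunE.
by rewrite !linearD /= Hs Ht.
Qed.

Lemma tassoc_nat (U U' V V' W W' : vectType K)
    (f : 'Hom(U, U')) (g : 'Hom(V, V')) (h : 'Hom(W, W')) t :
  tassoc U' V' W' (tmap (tmap f g) h t) =
  tmap f (tmap g h) (tassoc U V W t).
Proof.
elim/tensor_ind: t => [s w|s t Hs Ht]; last by rewrite !linearD /= Hs Ht.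
elim/tensor_ind: s => [u v|s t Hs Ht].
  by rewrite tmapE tmapE !tassocE !tmapE.
by rewrite pureDl !linearD /= Hs Ht.
Qed.

Lemma amullE (A : falgType K) (a x : A) : amull a x = a * x.
Proof. by rewrite lfunE. Qed.

Lemma amulrE (A : falgType K) (a x : A) : amulr a x = x * a.
Proof. by rewrite lfunE. Qed.

Definition trace (V : vectType K) (f : 'End(V)) : K :=
  \tr (passmx.mxof (vbasis {:V}) (vbasis {:V}) f).

Lemma trace_comm (U V : vectType K) (f : 'Hom(U, V)) (g : 'Hom(V, U)) :
  trace (g \o f)%VF = trace (f \o g)%VF.
Proof.
have fr (X : vectType K) : free (vbasis {:X}) by exact: basis_free (vbasisP _).
have bs (X : vectType K) : basis_of {:X} (vbasis {:X}) by exact: vbasisP.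
rewrite /trace (passmx.mxof_comp _ _ (bs V)) //.
by rewrite (passmx.mxof_comp _ _ (bs U)) // mxtrace_mulC.
Qed.

Lemma traceE (V : vectType K) (f : 'End(V)) :
  trace f = \sum_i coord (vbasis {:V}) i (f (vbasis {:V})`_i).
Proof.
apply: eq_bigr => i _.
by rewrite !mxE ?lfunE /= passmx.vecof_delta ?mxE.
Qed.

Lemma trace_is_linear (V : vectType K) : linear_for *%R (@trace V).
Proof.
move=> a f g; rewrite !traceE mulr_sumr -big_split; apply: eq_bigr => i _ /=.
by rewrite !lfunE /= lfunE linearP.
Qed.
HB.instance Definition _ (V : vectType K) :=
  GRing.isSemilinear.Build K 'End(V) K *%R (@trace V)
    (GRing.semilinear_linear (@trace_is_linear V)).

Lemma traceD (V : vectType K) (f g : 'End(V)) :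
  trace (f + g) = trace f + trace g.
Proof. exact: linearD. Qed.

Lemma trace_rank1 (V : vectType K) (xi : 'Hom(V, K^o)) (d : V) (f : 'End(V)) :
  (forall z, f z = (xi z : K) *: d) -> trace f = xi d.
Proof.
move=> fE; rewrite [d in RHS](coord_vbasis (memvf d)) linear_sum traceE.
by apply: eq_bigr => i _; rewrite fE !linearZ /= mulrC.
Qed.

End TensorMaps.

(** * Tensor powers of an algebra and the trace of rotation operators *)

Section Tower.
Variables (K : fieldType) (A : falgType K).

(* A^(⊗(n+1)), like [tpow], but as an algebra. *)
Fixpoint tpow_alg (n : nat) : falgType K :=
  if n is n'.+1 then tensor A (tpow_alg n') else A.
Local Notation B := tpow_alg.

Fixpoint tmults (n : nat) : 'Hom(B n, A) :=
  if n is n'.+1 return 'Hom(B n, A)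
  then (tmult A \o tmap \1 (tmults n'))%VF else \1%VF.

(* Reassociates (a_0 ⊗ (a_1 ⊗ ... ⊗ a_n)) ⊗ y as a_0 ⊗ (a_1 ⊗ ... ⊗ a_n ⊗ y). *)
Fixpoint tshift (n : nat) : 'AHom(tensor (B n) A, tensor A (B n)) :=
  if n is n'.+1 return 'AHom(tensor (B n) A, tensor A (B n))
  then comp_ahom (tmap_ahom (id_ahom A) (tshift n')) (tassoc_ahom A (B n') A)
  else id_ahom (tensor A A).

Lemma tmults_pure n x (b : B n) : tmults n.+1 (x ⊗ b) = x * tmults n b.
Proof. by rewrite /= comp_lfunE tmapE id_lfunE tmultE. Qed.

Lemma tshift_pure n x (b : B n) y :
  tshift n.+1 ((x ⊗ b) ⊗ y) = x ⊗ tshift n (b ⊗ y).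
Proof. by rewrite /= comp_lfunE tassocE tmapE id_lfunE. Qed.

Lemma tshift0 (t : tensor A A) : tshift 0 t = t.
Proof. exact: id_lfunE. Qed.

Definition tact n (T : 'Hom(A, B n)) : 'Hom(tensor A (B n), B n) :=
  (tmult (B n) \o tmap T \1)%VF.

Lemma tactE n (T : 'Hom(A, B n)) x b : tact T (x ⊗ b) = T x * b.
Proof. by rewrite comp_lfunE tmapE id_lfunE tmultE. Qed.

(* z_0 ⊗ ... ⊗ z_n |-> T(z_0) (z_1 ⊗ ... ⊗ z_n ⊗ k) *)
Definition trot n (T : 'Hom(A, B n)) (k : A) : 'End(B n) :=
  (tact T \o tshift n \o tensr (B n) k)%VF.

Lemma trotE n (T : 'Hom(A, B n)) k z : trot T k z = tact T (tshift n (z ⊗ k)).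
Proof. by rewrite !comp_lfunE tensrE. Qed.

Definition contract (V : vectType K) (xi : 'Hom(A, K^o)) :
  'Hom(tensor A V, V) := (tunitl V \o tmap xi \1)%VF.

Lemma contractE (V : vectType K) (xi : 'Hom(A, K^o)) x (v : V) :
  contract V xi (x ⊗ v) = (xi x : K) *: v.
Proof. by rewrite comp_lfunE tmapE id_lfunE tunitlE. Qed.

(** Induction on n. In degree n+1, f factors through the contraction of the first slot by [xi].
    Exchanging the two factors under the trace and taking d = x ⊗ b by linearity leaves an operator
    of the same shape in degree n, with b for d and with [xi] precomposed with left multiplication
    by x. *)
Lemma trace_trot_rank1 n (xi : 'Hom(A, K^o)) (d : B n) (k : A) (f : 'End(B n)) :
  (forall z, f z = d * contract (B n) xi (tshift n (z ⊗ k))) ->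
  trace f = xi (tmults n d * k).
Proof.
elim: n xi d f => [|n IHn] xi d f fE.
  rewrite /= id_lfunE; apply: trace_rank1 => z.
  by rewrite fE tshift0 contractE -scalerAr.
pose g (d : B n.+1) : 'Hom(B n, B n.+1) :=
  (amull d \o tshift n \o tensr (B n) k)%VF.
have gE d' z : g d' z = d' * tshift n (z ⊗ k).
  by rewrite !comp_lfunE tensrE amullE.
have -> : f = (g d \o contract (B n) xi)%VF.
  apply/lfunP; elim/tensor_ind=> [x b|s t Hs Ht]; last first.
    by rewrite !linearD /= Hs Ht.
  rewrite fE (comp_lfunE (g d)) gE tshift_pure !contractE.
  by rewrite pureZl linearZ -scalerAr.
rewrite trace_comm {fE f}.
have gD s t : g (s + t) = g s + g t.
  by apply/lfunP => z; rewrite add_lfunE !gE mulrDl.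
elim/tensor_ind: d => [x b|s t Hs Ht]; last first.
  by rewrite gD comp_lfunDr traceD Hs Ht linearD mulrDl [RHS]linearD.
rewrite (IHn (xi \o amull x)%VF b) => [|z].
  by rewrite comp_lfunE tmults_pure amullE mulrA.
rewrite (comp_lfunE (contract _ _)) gE.
elim/tensor_ind: (tshift n _) => [y c|s t Hs Ht].
  by rewrite pureM !contractE comp_lfunE amullE -scalerAr.
by rewrite mulrDr !linearD /= Hs Ht mulrDr.
Qed.

(** Expanding z_0 in the basis (e_i) of A writes the operator as a sum of those of
    [trace_trot_rank1], with d = T(e_i) and [xi] the i-th coordinate form. This brings traces on
    A^(⊗(n+1)) down to traces on A. *)
Lemma trace_trot n (T : 'Hom(A, B n)) (k : A) :
  trace (trot T k) = trace (amulr k \o tmults n \o T)%VF.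
Proof.
pose e := vbasis {:A}.
pose xi (i : 'I_(\dim {:A})) : 'Hom(A, K^o) := linfun (coord e i : A -> K^o).
pose R (i : 'I_(\dim {:A})) : 'End(B n) :=
  (amull (T e`_i) \o contract (B n) (xi i) \o tshift n \o tensr (B n) k)%VF.
have RE i z : R i z = T e`_i * contract (B n) (xi i) (tshift n (z ⊗ k)).
  by rewrite !comp_lfunE tensrE amullE.
have -> : trot T k = \sum_i R i.
  apply/lfunP => z; rewrite trotE sum_lfunE.
  rewrite (eq_bigr _ (fun i _ => RE i z)).
  elim/tensor_ind: (tshift n _) => [x b|s t Hs Ht].
    rewrite tactE {1}(coord_vbasis (memvf x)) linear_sum mulr_suml.
    apply: eq_bigr => i _.
    by rewrite contractE lfunE linearZ /= -scalerAl -scalerAr.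
  rewrite linearD /= Hs Ht -big_split; apply: eq_bigr => i _ /=.
  by rewrite linearD mulrDr.
rewrite linear_sum traceE; apply: eq_bigr => i _.
rewrite /= (trace_trot_rank1 (RE i)) lfunE !comp_lfunE amulrE //.
Qed.
End Tower.

(** * The convolution algebra of maps from a bialgebra to an algebra *)

Section Convolution.
Variables (K : fieldType) (C : bialgType K).
Local Notation eps := (@counit K C).

Definition conv (A : falgType K) (f g : 'Hom(C, A)) : 'Hom(C, A) :=
  (tmult A \o tmap f g \o comul)%VF.

Definition conv1 (A : falgType K) : 'Hom(C, A) := (scalar_lfun A \o eps)%VF.

Lemma convE (A : falgType K) (f g : 'Hom(C, A)) x :
  conv f g x = tmult A (tmap f g (comul x)).
Proof. by rewrite !comp_lfunE. Qed.

Lemma conv1E (A : falgType K) x : conv1 A x = (eps x : K)%:A.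
Proof. by rewrite comp_lfunE lfunE. Qed.

Lemma convA (A : falgType K) (f g h : 'Hom(C, A)) :
  conv f (conv g h) = conv (conv f g) h.
Proof.
apply/lfunP => x; rewrite !convE.
have -> : tmap f (conv g h) (comul x) =
    tmap f (tmult A \o tmap g h)%VF (tmap \1 comul (comul x)).
  by rewrite tmap_comp comp_lfun1r.
have -> : tmap (conv f g) h (comul x) =
    tmap (tmult A \o tmap f g)%VF h (tmap comul \1 (comul x)).
  by rewrite tmap_comp comp_lfun1r.
rewrite -coassoc; elim/tensor_ind: (tmap comul _ _) => [s c|s t Hs Ht].
  elim/tensor_ind: s => [a b|s t Hs Ht].
    by rewrite tassocE !tmapE !tmultE !comp_lfunE !tmapE !tmultE mulrA.
  by rewrite pureDl !linearD /= Hs Ht.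
by rewrite !linearD /= Hs Ht.
Qed.

Lemma conv1l (A : falgType K) (f : 'Hom(C, A)) : conv (conv1 A) f = f.
Proof.
apply/lfunP => x; rewrite convE -[in RHS](counitl x).
elim/tensor_ind: (comul x) => [a b|s t Hs Ht]; last first.
  by rewrite !linearD /= Hs Ht.
by rewrite !tmapE tmultE conv1E id_lfunE tunitlE linearZ /= mulr_algl.
Qed.

Lemma conv1r (A : falgType K) (f : 'Hom(C, A)) : conv f (conv1 A) = f.
Proof.
apply/lfunP => x; rewrite convE -[in RHS](counitr x).
elim/tensor_ind: (comul x) => [a b|s t Hs Ht]; last first.
  by rewrite !linearD /= Hs Ht.
by rewrite !tmapE tmultE conv1E id_lfunE tunitrE linearZ /= mulr_algr.
Qed.

Lemma conv_ahom (A A' : falgType K) (phi : 'AHom(A, A')) (f g : 'Hom(C, A)) :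
  conv (phi \o f) (phi \o g) = (phi \o conv f g)%VF.
Proof.
apply/lfunP => x; rewrite [RHS]comp_lfunE !convE.
elim/tensor_ind: (comul x) => [a b|s t Hs Ht]; last first.
  by rewrite !linearD /= Hs Ht.
by rewrite !tmapE !tmultE !comp_lfunE rmorphM.
Qed.

Lemma conv1_ahom (A A' : falgType K) (phi : 'AHom(A, A')) :
  (phi \o conv1 A)%VF = conv1 A'.
Proof.
by apply/lfunP => x; rewrite [LHS]comp_lfunE !conv1E linearZ /= rmorph1.
Qed.

Lemma conv_inv_uniq (A : falgType K) (f g h : 'Hom(C, A)) :
  conv f g = conv1 A -> conv g h = conv1 A -> f = h.
Proof. by move=> fg gh; rewrite -[f]conv1r -gh convA fg conv1l. Qed.

End Convolution.

(** * Iterated comultiplications as algebra maps *)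

Section IteratedComul.
Variables (K : fieldType) (A : falgType K) (c : 'AHom(A, tensor A A)).

(** The map [c] is a parameter so that the same iteration serves the comultiplication of H and that
    of a twist. *)
Fixpoint tcomuls (n : nat) : 'AHom(A, tpow_alg A n) :=
  if n is n'.+1 return 'AHom(A, tpow_alg A n)
  then comp_ahom (tmap_ahom (id_ahom A) (tcomuls n')) c else id_ahom A.

(* The index is shifted: this is P_(n+1). *)
Definition spower n : 'End(A) := (tmults A n \o tcomuls n)%VF.

Lemma tcomulsS n : tcomuls n.+1 = (tmap \1 (tcomuls n) \o c)%VF :> 'Hom(_, _).
Proof. by []. Qed.

Lemma spower0 : spower 0 = \1%VF.
Proof. exact: comp_lfun1l. Qed.

Lemma spowerS n x : spower n.+1 x = tmult A (tmap \1 (spower n) (c x)).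
Proof.
rewrite /spower /= !comp_lfunE tmap_comp.
by rewrite comp_lfun1l.
Qed.

End IteratedComul.

(** * Properties of the antipode, and its commutation with Sweedler powers *)

Section Hopf.
Variables (K : fieldType) (H : hopfAlgType K).
Local Notation S := (@antipode K H).
Local Notation eps := (@counit K H).
Local Notation B := (tpow_alg H).
Local Notation D n := (tcomuls (@comul K H) n).

Lemma sweedler_spower n : sweedler_power H n.+1 = spower (@comul K H) n.
Proof.
elim: n => [|n IHn]; first by [].
apply/lfunP => x; rewrite spowerS -IHn.
by rewrite /= !comp_lfunE tmap_comp comp_lfun1l.
Qed.

Lemma conv_antipodel : conv S \1 = conv1 H H.
Proof. by apply/lfunP => x; rewrite convE conv1E antipodel. Qed.

Lemma conv_antipoder : conv \1 S = conv1 H H.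
Proof. by apply/lfunP => x; rewrite convE conv1E antipoder. Qed.

Lemma conv_tens (A A' : falgType K) (f : 'Hom(H, A)) (g : 'Hom(H, A')) :
  conv (tensr1 A A' \o f) (tensl1 A A' \o g) = (tmap f g \o comul)%VF.
Proof.
apply/lfunP => x; rewrite [RHS]comp_lfunE convE.
elim/tensor_ind: (comul x) => [a b|s t Hs Ht]; last first.
  by rewrite !linearD /= Hs Ht.
by rewrite !tmapE tmultE !comp_lfunE tensr1E tensl1E pureM mul1r mulr1.
Qed.

(* h ⊗ k = Σ Δ(h₁)(1 ⊗ S(h₂)k), so a map out of H ⊗ H is determined by its
   values on the elements Δ(h)(1 ⊗ k). *)
Lemma galois_antipode (V : vectType K) (Z : 'Hom(tensor H H, V))
    (Y : 'Hom(H, V)) :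
  (forall h k, Z (comul h * (1 ⊗ k)) = (eps h : K) *: Y k) ->
  forall h k, Z (h ⊗ k) = Y (S h * k).
Proof.
move=> ZY h k.
(* Δ is the convolution of h |-> h ⊗ 1 and h |-> 1 ⊗ h, and convolving on the right with h |-> 1 ⊗
   S(h) cancels the second factor. *)
have e : conv comul (tensl1 H H \o S)%VF = tensr1 H H :> 'Hom(_, _).
  have {1}-> : (comul : 'Hom(_, _)) = conv (tensr1 H H) (tensl1 H H).
    rewrite -[X in conv X _]comp_lfun1r -[X in conv _ X]comp_lfun1r conv_tens.
    by apply/lfunP => x; rewrite comp_lfunE tmap1.
  rewrite -convA -[X in conv X (_ \o S)%VF]comp_lfun1r conv_ahom.
  by rewrite conv_antipoder conv1_ahom conv1r.
have -> : h ⊗ k = conv comul (tensl1 H H \o S)%VF h * (1 ⊗ k).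
  by rewrite e tensr1E pureM mul1r mulr1.
rewrite -[in RHS](counitl h) convE.
elim/tensor_ind: (comul h) => [a b|s t Hs Ht]; last first.
  by rewrite !linearD /= mulrDl !linearD /= Hs Ht mulrDl linearD.
rewrite !tmapE tmultE comp_lfunE tensl1E id_lfunE tunitlE -mulrA pureM mulr1.
by rewrite ZY linearZ /= -scalerAl linearZ.
Qed.

Definition mulSl : 'Hom(tensor H H, H) := (tmult H \o tmap S \1)%VF.

Lemma mulSlE x y : mulSl (x ⊗ y) = S x * y.
Proof. by rewrite comp_lfunE tmapE id_lfunE tmultE. Qed.

Lemma mulSl_mulr t k : mulSl (t * (1 ⊗ k)) = mulSl t * k.
Proof.
elim/tensor_ind: t => [a b|s t Hs Ht]; last first.
  by rewrite mulrDl !linearD /= Hs Ht mulrDl.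
by rewrite pureM mulr1 !mulSlE mulrA.
Qed.

Lemma mulSl_comul h : mulSl (comul h) = (eps h : K)%:A.
Proof. by rewrite -antipodel comp_lfunE. Qed.

(** By [galois_antipode] it is enough to replace y ⊗ k by Δ(a)(1 ⊗ b); then Δ(h)Δ(a) = Δ(ha) and the
    antipode axiom applies to ha. *)
Lemma mulSl_comulM h y k : mulSl (comul h * (y ⊗ k)) = (eps h : K) *: (S y * k).
Proof.
have := @galois_antipode H (mulSl \o amull (comul h))%VF ((eps h : K) *: \1%VF).
move=> /(_ _ y k); rewrite comp_lfunE amullE scale_lfunE id_lfunE; apply=> a b.
rewrite comp_lfunE amullE scale_lfunE id_lfunE mulrA -rmorphM.
rewrite mulSl_mulr mulSl_comul.
by rewrite rmorphM /= mulr_algl scalerA mulrC.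
Qed.

(** Both sides are values at x ⊗ 1 of maps compared by [galois_antipode]; on Δ(h)(1 ⊗ k) the
    comparison is [mulSl_comulM]. *)
Lemma antipodeM x y : S (x * y) = S y * S x.
Proof.
have := @galois_antipode H (mulSl \o amulr (y ⊗ 1))%VF (amull (S y)).
move=> /(_ _ x 1); rewrite comp_lfunE amulrE amullE pureM mulSlE !mulr1.
apply=> h k; rewrite comp_lfunE amulrE amullE -mulrA pureM mul1r mulr1.
exact: mulSl_comulM.
Qed.

Lemma antipode1 : S 1 = 1.
Proof.
by have := mulSl_comul 1; rewrite !rmorph1 -pure1 mulSlE mulr1 scale1r.
Qed.

(* h |-> S(h_(n+1)) ⊗ ... ⊗ S(h_1), the convolution inverse of [tcomuls]. *)
Fixpoint tcomuls_inv n : 'Hom(H, B n) :=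
  if n is n'.+1 return 'Hom(H, B n)
  then conv (tensl1 H (B n') \o tcomuls_inv n') (tensr1 H (B n') \o S) else S.

Lemma tcomuls_invS n : tcomuls_inv n.+1 =
  conv (tensl1 H (B n) \o tcomuls_inv n) (tensr1 H (B n) \o S).
Proof. by []. Qed.

Lemma tcomuls_conv n : D n.+1 = conv (tensr1 H (B n)) (tensl1 H (B n) \o D n)
  :> 'Hom(H, B n.+1).
Proof. by rewrite -[X in conv X]comp_lfun1r conv_tens. Qed.

Lemma tcomuls_invr n : conv (D n) (tcomuls_inv n) = conv1 H (B n).
Proof.
elim: n => [|n IHn]; first exact: conv_antipoder.
rewrite tcomuls_conv tcomuls_invS -convA.
rewrite (convA (tensl1 _ _ \o D n)%VF) conv_ahom IHn conv1_ahom.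
rewrite conv1l -[X in conv X _]comp_lfun1r conv_ahom conv_antipoder.
exact: conv1_ahom.
Qed.

(** Since [D n] is an algebra map, [D n \o S] is a left convolution inverse of it, while
    [tcomuls_inv n] is a right one. *)
Lemma tcomuls_antipode n : (D n \o S)%VF = tcomuls_inv n.
Proof.
apply: conv_inv_uniq (tcomuls_invr n).
by rewrite -[X in conv _ X]comp_lfun1r conv_ahom conv_antipodel conv1_ahom.
Qed.

Lemma spower_conv n : spower comul n.+1 = conv \1 (spower (@comul K H) n).
Proof. by apply/lfunP => x; rewrite spowerS convE. Qed.

Lemma spower_convr n : spower comul n.+1 = conv (spower (@comul K H) n) \1.
Proof.
elim: n => [|n IHn]; first by rewrite spower_conv spower0.
by rewrite spower_conv {1}IHn spower_conv convA.
Qed.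

(** By [tcomuls_antipode], applying S first yields the product S(h_(n+1)) ... S(h_1), which is S(h_1
    ... h_(n+1)). The first slot of [tcomuls_inv] holds the last component of h, so the induction
    peels P off on the right, by [spower_convr]. *)
Lemma spower_antipode n :
  (spower comul n \o S)%VF = (S \o spower (@comul K H) n)%VF.
Proof.
rewrite -comp_lfunA tcomuls_antipode.
elim: n => [|n IHn]; first by rewrite spower0 comp_lfun1l comp_lfun1r.
rewrite spower_convr tcomuls_invS; apply/lfunP => x.
rewrite [LHS]comp_lfunE [RHS]comp_lfunE; rewrite !convE.
elim/tensor_ind: (comul x) => [a b|s t Hs Ht]; last first.
  by rewrite !linearD /= Hs Ht.
rewrite !tmapE !tmultE [(tensl1 _ _ \o _)%VF _]comp_lfunE.
rewrite [(tensr1 _ _ \o _)%VF _]comp_lfunE tensl1E tensr1E pureM mul1r mulr1.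
rewrite tmults_pure antipodeM id_lfunE.
by have /lfunP/(_ a) := IHn; rewrite [LHS]comp_lfunE [RHS]comp_lfunE => ->.
Qed.

End Hopf.
Arguments mulSl {K H}.

(** * Iterated comultiplications of a twist *)

Section TwistedComul.
Variables (K : fieldType) (H : bialgType K) (F : tensor H H).
Hypothesis cF : two_cocycle F.
Local Notation B := (tpow_alg H).
Local Notation D n := (tcomuls (@comul K H) n).

Let uF : F \is a GRing.unit. Proof. by case: cF => [[]]. Qed.

(* The element of H^(⊗(n+1)) that conjugates the iterated comultiplications of H
   into those of H^F. *)
Fixpoint twist_fac n : B n :=
  if n is n'.+1 return B n
  then ((1 : H) ⊗ twist_fac n') * tmap \1 (D n') F else 1.

Fixpoint twist_fac_inv n : B n :=
  if n is n'.+1 return B n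
  then tmap \1 (D n') F^-1 * ((1 : H) ⊗ twist_fac_inv n') else 1.

Lemma twist_facS n :
  twist_fac n.+1 = ((1 : H) ⊗ twist_fac n) * tmap \1 (D n) F.
Proof. by []. Qed.

Lemma twist_fac_invS n :
  twist_fac_inv n.+1 = tmap \1 (D n) F^-1 * ((1 : H) ⊗ twist_fac_inv n).
Proof. by []. Qed.

Lemma twist_facK n : twist_fac n * twist_fac_inv n = 1.
Proof.
elim: n => [|n IHn]; first exact: mulr1.
rewrite twist_facS twist_fac_invS mulrA -(mulrA ((1 : H) ⊗ _)) -rmorphM /=.
by rewrite mulrV // rmorph1 mulr1 pureM IHn mulr1.
Qed.

Lemma twist_fac_invK n : twist_fac_inv n * twist_fac n = 1.
Proof.
elim: n => [|n IHn]; first exact: mulr1.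
rewrite twist_facS twist_fac_invS mulrA.
rewrite -(mulrA _ ((1 : H) ⊗ _) ((1 : H) ⊗ _)).
by rewrite pureM IHn mulr1 pure1 mulr1 -rmorphM mulVr // rmorph1.
Qed.

Lemma tcomuls_twist n h :
  tcomuls (twist_comul_ahom cF) n h = twist_fac n * D n h * twist_fac_inv n.
Proof.
elim: n h => [|n IHn] h; first by rewrite mul1r mulr1.
rewrite tcomulsS comp_lfunE twist_comulE.
have -> t : tmap \1 (tcomuls (twist_comul_ahom cF) n) t =
    ((1 : H) ⊗ twist_fac n) * tmap \1 (D n) t * (1 ⊗ twist_fac_inv n).
  elim/tensor_ind: t => [a b|s t Hs Ht]; last first.
    by rewrite !linearD /= Hs Ht mulrDr mulrDl.
  by rewrite !tmapE IHn !pureM !id_lfunE mul1r mulr1.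
rewrite twist_facS twist_fac_invS tcomulsS [in RHS]comp_lfunE.
by rewrite !rmorphM !mulrA.
Qed.

(** Coassociativity: splitting off the last or the first factor gives the same iterated
    comultiplication. *)
Lemma tshift_comul n h :
  tshift H n (tmap (D n) \1 (comul h)) = tmap \1 (D n) (comul h).
Proof.
elim: n h => [|n IHn] h; first by rewrite tshift0.
have -> : tmap (D n.+1) \1 (comul h) =
    tmap (tmap \1 (D n)) \1 (tmap comul \1 (comul h)).
  by rewrite tmap_comp comp_lfun1r.
rewrite comp_lfunE tassoc_nat coassoc !tmap_comp !comp_lfun1r.
congr (tmap _ _ _); apply/lfunP => x; rewrite [RHS]comp_lfunE -IHn.
by rewrite !comp_lfunE.
Qed.

(** The case n = 1 is the cocycle identity. The induction step applies that identity to the first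
    slots, so that both sides become maps applied to (1 ⊗ F)(id ⊗ Δ)(F), and then compares the
    remaining slots. *)
Lemma tshift_cocycle n :
  ((1 : H) ⊗ twist_fac n) * tmap \1 (D n) F =
    tshift H n ((twist_fac n ⊗ (1 : H)) * tmap (D n) \1 F).
Proof.
have [_ eF] := cF.
elim: n => [|n IHn]; first by rewrite tshift0 pure1 !mul1r.
pose T := tassoc H H H.
have e1 : ((1 : H) ⊗ twist_fac n.+1) * tmap \1 (D n.+1) F =
    ((1 : H) ⊗ ((1 : H) ⊗ twist_fac n)) *
    tmap \1 (tmap \1 (D n)) (((1 : H) ⊗ F) * tmap \1 comul F).
  rewrite rmorphM /= tmap_comp comp_lfun1r tmapE id_lfunE mulrA pureM mulr1.
  by [].
have e2 : tshift H n.+1 ((twist_fac n.+1 ⊗ (1 : H)) * tmap (D n.+1) \1 F) =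
   tmap \1 (tshift H n) (((1 : H) ⊗ (twist_fac n ⊗ (1 : H))) *
     tmap \1 (tmap (D n) \1) (((1 : H) ⊗ F) * tmap \1 comul F)).
  rewrite eF -tassoc_nat [LHS]comp_lfunE; congr (tmap _ _ _).
  rewrite -tassocE -rmorphM; congr (tassoc _ _ _ _).
  rewrite rmorphM /= tmap_comp comp_lfun1r tmapE id_lfunE mulrA pureM mulr1.
  by [].
(* Only the F under [tmap \1 comul] is split into pure tensors; the one in 1 ⊗ F stays whole for the
   induction hypothesis. *)
rewrite e1 e2; elim/tensor_ind: {2 4}F => [a b|s t Hs Ht]; last first.
  by rewrite !linearD /= !mulrDr !linearD /= !mulrDr !linearD /= Hs Ht.
rewrite tmapE pureM mul1r !tmapE !pureM mul1r !tmapE !id_lfunE; congr (_ ⊗ _).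
rewrite !rmorphM /= !mulrA IHn rmorphM /= -mulrA -tshift_comul.
by rewrite !mulrA.
Qed.

End TwistedComul.

(** * Rotation operators built from the antipode *)

Section RotAntipode.
Variables (K : fieldType) (H : hopfAlgType K).
Local Notation S := (@antipode K H).
Local Notation eps := (@counit K H).
Local Notation D n := (tcomuls (@comul K H) n).

(** On x ⊗ b the left side is Σ D(S(h_1 x)) D(h_2) b = Σ D(S(x) S(h_1) h_2) b, where the antipode
    axiom collapses S(h_1) h_2. *)
Lemma tact_comulM n h X :
  tact (D n \o S) (tmap \1 (D n) (comul h) * X) =
  (eps h : K) *: tact (D n \o S) X.
Proof.
elim/tensor_ind: X => [x b|s t Hs Ht]; last first.
  by rewrite mulrDr !linearD /= Hs Ht.
have e t : tact (D n \o S) (tmap \1 (D n) t * (x ⊗ b)) =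
    D n (S x * mulSl t) * b.
  elim/tensor_ind: t => [f g|t t' Ht Ht']; last first.
    by rewrite !linearD /= mulrDl !linearD /= mulrDr linearD mulrDl Ht Ht'.
  rewrite tmapE pureM tactE comp_lfunE id_lfunE mulSlE antipodeM !mulrA.
  by rewrite -rmorphM.
by rewrite e mulSl_comul mulr_algr linearZ /= -scalerAl tactE comp_lfunE.
Qed.

(** For s = h ⊗ k, left multiplication of z by D(h) turns into the factor S(h) in the last slot. By
    [galois_antipode] only s = Δ(h)(1 ⊗ k) matters; there [tshift_comul] moves Δ(h) to the form
    absorbed by [tact_comulM]. *)
Lemma trot_antipode n (z : tpow_alg H n) s :
  tact (D n \o S) (tshift H n (tmap (D n) \1 s * (z ⊗ 1))) =
  trot (D n \o S) (mulSl s) z.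
Proof.
elim/tensor_ind: s => [h k|s t Hs Ht]; last first.
  rewrite linearD mulrDl 2!linearD /= Hs Ht !trotE.
  by rewrite linearD pureDr !linearD.
pose Z : 'Hom(tensor H H, tpow_alg H n) :=
 (tact (D n \o S) \o tshift H n \o amulr (z ⊗ 1%R) \o tmap (D n) \1)%VF.
pose Y : 'Hom(H, tpow_alg H n) :=
  (tact (D n \o S) \o tshift H n \o tensl H z)%VF.
have ZE t : Z t = tact (D n \o S) (tshift H n (tmap (D n) \1 t * (z ⊗ 1))).
  by rewrite 3!comp_lfunE amulrE.
have YE k' : Y k' = tact (D n \o S) (tshift H n (z ⊗ k')).
  by rewrite 2!comp_lfunE tenslE.
rewrite -ZE trotE mulSlE -YE; apply: galois_antipode => {}h {}k.
rewrite ZE YE !rmorphM /= tshift_comul -mulrA -rmorphM tact_comulM.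
by rewrite tmapE rmorph1 id_lfunE pureM mul1r mulr1.
Qed.

End RotAntipode.

(** * The antipode of a twist and the invariance of the traces *)

Section TwistedTrace.
Variables (K : fieldType) (H : hopfAlgType K) (F : tensor H H).
Hypothesis cF : two_cocycle F.
Local Notation S := (@antipode K H).
Local Notation eps := (@counit K H).
Local Notation B := (tpow_alg H).
Local Notation D n := (tcomuls (@comul K H) n).
Local Notation DF n := (tcomuls (twist_comul_ahom cF) n).

Let uF : F \is a GRing.unit. Proof. by case: cF => [[]]. Qed.

Definition mulSw (w : H) : 'Hom(tensor H H, H) :=
  (tmult H \o tmap (amulr w \o S) \1)%VF.

Lemma mulSwE w x y : mulSw w (x ⊗ y) = S x * w * y.
Proof. by rewrite comp_lfunE tmapE comp_lfunE amulrE id_lfunE tmultE. Qed.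

(** S(x) S(a) merges into S(a x). With s = F^-1 and t = F this gives Σ S(f) w g = 1. *)
Lemma mulSw_mulSl s t : mulSw (mulSl s) t = mulSl (s * t).
Proof.
elim/tensor_ind: t => [x y|t t' Ht Ht']; last first.
  by rewrite mulrDr !linearD /= Ht Ht'.
rewrite mulSwE; elim/tensor_ind: s => [a b|s s' Hs Hs']; last first.
  by rewrite mulrDl !linearD /= mulrDr mulrDl Hs Hs'.
by rewrite pureM !mulSlE antipodeM !mulrA.
Qed.

Definition mulSr : 'Hom(tensor H H, H) := (tmult H \o tmap \1 S)%VF.

Lemma mulSrE x y : mulSr (x ⊗ y) = x * S y.
Proof. by rewrite comp_lfunE tmapE id_lfunE tmultE. Qed.

Let w := mulSl F^-1.
Let u := mulSr F.

Lemma mulSw_twist : mulSw w F = 1.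
Proof. by rewrite mulSw_mulSl mulVr // -pure1 mulSlE antipode1 mulr1. Qed.

(* Apply x ⊗ y ⊗ z |-> x S(y) z to the form
   (1 ⊗ F^-1)(F ⊗ 1) = (id ⊗ Δ)(F) (Δ ⊗ id)(F^-1) of the cocycle identity. *)
Lemma mulSr_mulSl_twist : u * w = 1.
Proof.
have [[_ el er] eF] := cF.
pose T := tassoc H H H.
pose m3 : 'Hom(tensor H (tensor H H), H) := (tmult H \o tmap \1 mulSl)%VF.
have m3E x t : m3 (x ⊗ t) = x * mulSl t.
  by rewrite comp_lfunE tmapE id_lfunE tmultE.
have m3l s t : m3 (((1 : H) ⊗ s) * T (t ⊗ (1 : H))) = mulSr t * mulSl s.
  elim/tensor_ind: t => [a b|t t' Ht Ht']; last first.
    by rewrite pureDl !linearD /= mulrDr !linearD /= Ht Ht' mulrDl.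
  rewrite tassocE pureM mul1r m3E mulSrE -mulrA; congr (_ * _).
  elim/tensor_ind: s => [x y|t t' Ht Ht']; last first.
    by rewrite mulrDl !linearD /= mulrDr Ht Ht'.
  by rewrite pureM mulr1 !mulSlE antipodeM mulrA.
have m3T r k : m3 (T (r ⊗ k)) = mulSr r * k.
  elim/tensor_ind: r => [a b|t t' Ht Ht']; last first.
    by rewrite pureDl !linearD /= Ht Ht' mulrDl.
  by rewrite tassocE m3E mulSlE mulSrE mulrA.
have m3c f g X : m3 ((f ⊗ comul g) * X) = (eps g : K) *: (f * m3 X).
  elim/tensor_ind: X => [x t|t t' Ht Ht']; last first.
    by rewrite mulrDr !linearD /= mulrDr scalerDr Ht Ht'.
  rewrite pureM !m3E; elim/tensor_ind: t => [y z|t t' Ht Ht']; last first.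
    by rewrite mulrDr !linearD /= !mulrDr scalerDr Ht Ht'.
  by rewrite mulSl_comulM mulSlE -scalerAr !mulrA.
(* On the right side of that form the value is a product of the counit normalisations of F and F^-1,
   both equal to 1. *)
have m3r s t : m3 (tmap \1 comul t * T (tmap comul \1 s)) =
    tunitr H (tmap \1 counit t) * tunitl H (tmap counit \1 s).
  elim/tensor_ind: t => [f g|t t' Ht Ht']; last first.
    by rewrite !linearD /= !mulrDl !linearD /= Ht Ht'.
  rewrite tmapE m3c tmapE !id_lfunE tunitrE -scalerAl; congr (_ *: (_ * _)).
  elim/tensor_ind: s => [a k|t t' Ht Ht']; last first.
    by rewrite !linearD /= Ht Ht'.
  rewrite !tmapE m3T tunitlE !id_lfunE.
  by rewrite [mulSr _]comp_lfunE antipoder mulr_algl.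
have el' : tunitl H (tmap counit \1 F^-1) = 1.
  by rewrite -[LHS]mul1r -{1}el -2!rmorphM mulrV // !rmorph1.
have := m3r F^-1 F; rewrite er el' mulr1 => <-.
rewrite -m3l; congr (m3 _).
have -> : tmap \1 comul F = ((1 : H) ⊗ F^-1) * T ((F ⊗ 1) * tmap comul \1 F).
  by rewrite -eF mulrA pureM mulVr // mulr1 pure1 mul1r.
by rewrite -mulrA -rmorphM -mulrA ahom_inv // mulr1.
Qed.

(** On Y = x ⊗ y the factor F contributes Σ S(f) w g = 1 between S(x) and y. With Y = Δ(h)F^-1 this
    serves the left antipode axiom of H^F. *)
Lemma mulSl_twist_comul (Y : tensor H H) :
  tmult H (tmap (amull u \o amulr w \o S) \1 (F * Y)) = u * mulSl Y.
Proof.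
have e (s : tensor H H) (x y : H) :
    tmult H (tmap (amull u \o amulr w \o S) \1 (s * (x ⊗ y))) =
    u * (S x * mulSw w s * y).
  elim/tensor_ind: s => [f g|t1 t2 Ht Ht']; last first.
    by rewrite mulrDl !linearD /= mulrDr mulrDl mulrDr Ht Ht'.
  rewrite pureM tmapE tmultE 2!comp_lfunE amullE amulrE.
  rewrite antipodeM id_lfunE mulSwE.
  by rewrite !mulrA.
elim/tensor_ind: Y => [x y|t1 t2 Ht Ht']; last first.
  by rewrite mulrDr !linearD /= mulrDr Ht Ht'.
by rewrite e mulSw_twist mulr1 mulSlE.
Qed.

Lemma mulSl_comulMr h s : mulSl (comul h * s) = (eps h : K) *: mulSl s.
Proof.
elim/tensor_ind: s => [x y|t1 t2 Ht Ht']; last first.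
  by rewrite mulrDr !linearD /= Ht Ht'.
by rewrite mulSl_comulM mulSlE.
Qed.

(** [SF] stands for the antipode of H^F, which is built only as a bialgebra; it will be transported
    from a gauge equivalent Hopf algebra. *)
Variable SF : 'End(H).
Hypothesis SFr : forall h,
  tmult H (tmap \1 SF (twist_comul F h)) = (eps h : K)%:A.

(** In convolution over the coalgebra H^F, x |-> u S(x) w is a left inverse of the identity and [SF]
    is a right inverse. *)
Lemma twist_antipodeE x : SF x = u * S x * w.
Proof.
pose SF' : 'Hom(twist cF, H) := (amull u \o amulr w \o S)%VF.
have el : @conv K (twist cF) H SF' \1%VF = conv1 (twist cF) H.
  apply/lfunP => h; rewrite convE conv1E.
  have -> : comul h = F * (comul (h : H) * F^-1).
    by rewrite mulrA -twist_comulE.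
  by rewrite mulSl_twist_comul mulSl_comulMr -scalerAr mulSr_mulSl_twist.
have er : @conv K (twist cF) H \1%VF SF = conv1 (twist cF) H.
  by apply/lfunP => h; rewrite convE conv1E; apply: SFr.
by rewrite -(conv_inv_uniq el er) 2!comp_lfunE amullE amulrE mulrA.
Qed.

Lemma trot_twist n (z : B n) :
  twist_fac_inv F n * trot (DF n \o SF) 1 (twist_fac F n * z) =
  D n u * trot (D n \o S) w z.
Proof.
have e1 X : tact (DF n \o SF) X = twist_fac F n *
    tact (D n \o SF) (((1 : H) ⊗ twist_fac_inv F n) * X).
  elim/tensor_ind: X => [x b|s t Hs Ht]; last first.
    by rewrite mulrDr !linearD /= mulrDr Hs Ht.
  by rewrite pureM mul1r !tactE !comp_lfunE tcomuls_twist !mulrA.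
have e2 X : tact (D n \o SF) (tmap \1 (D n) F * X) =
    D n u * tact (D n \o S) X.
  elim/tensor_ind: X => [x b|s t Hs Ht]; last first.
    by rewrite mulrDr !linearD /= mulrDr Hs Ht.
  have e t : tact (D n \o SF) (tmap \1 (D n) t * (x ⊗ b)) =
      D n (u * S x * mulSw w t) * b.
    elim/tensor_ind: t => [f g|t t' Ht Ht']; last first.
      by rewrite !linearD /= mulrDl !linearD /= mulrDr linearD mulrDl Ht Ht'.
    rewrite tmapE pureM tactE comp_lfunE id_lfunE twist_antipodeE mulSwE.
    by rewrite antipodeM !mulrA -rmorphM.
  by rewrite e mulSw_twist mulr1 rmorphM tactE comp_lfunE mulrA.
rewrite trotE e1 mulrA twist_fac_invK // mul1r.
have -> : (twist_fac F n * z) ⊗ (1 : H) = (twist_fac F n ⊗ 1) * (z ⊗ 1).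
  by rewrite pureM mulr1.
(* Inserting F F^-1 produces a side of [tshift_cocycle]; the leftover (D ⊗ id)(F^-1) becomes w in
   the last slot by [trot_antipode]. *)
have e3 : (twist_fac F n ⊗ (1 : H)) =
   (twist_fac F n ⊗ (1 : H)) * tmap (D n) \1 F * tmap (D n) \1 F^-1.
  by rewrite -mulrA ahom_inv ?mulr1.
rewrite e3 -mulrA rmorphM /= -tshift_cocycle // !mulrA pureM.
rewrite twist_fac_invK // mulr1 pure1 mul1r e2.
by rewrite trot_antipode.
Qed.

(** For t = f ⊗ g, D(f) is cycled around the trace and becomes S(f) in the last slot, while D(S g)
    is absorbed as right multiplication by g under S. Then [trace_trot] returns to H. *)
Lemma trace_mulSr n k t :
  trace (amull (D n (mulSr t)) \o trot (D n \o S) k)%VF =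
  trace (spower comul n \o S \o amulr (mulSw k t))%VF.
Proof.
elim/tensor_ind: t => [f g|s t Hs Ht]; last first.
  rewrite !linearD /= comp_lfunDl comp_lfunDr !traceD Hs Ht //.
rewrite mulSrE mulSwE.
have -> : (amull (D n (f * S g)) \o trot (D n \o S) k)%VF =
    (amull (D n f) \o (amull (D n (S g)) \o trot (D n \o S) k))%VF.
  by apply/lfunP => z; rewrite !comp_lfunE !amullE rmorphM mulrA.
rewrite trace_comm.
have -> : ((amull (D n (S g)) \o trot (D n \o S) k) \o amull (D n f))%VF =
    trot (D n \o S \o amulr g) (S f * k).
  apply/lfunP => z; rewrite 2!comp_lfunE !amullE.
  have := trot_antipode z (f ⊗ k).
  rewrite tmapE pureM mulr1 id_lfunE -trotE mulSlE => ->; rewrite !trotE.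
  elim/tensor_ind: (tshift _ _ _) => [x b|s t Hs Ht]; last first.
    by rewrite !linearD /= mulrDr Hs Ht.
  by rewrite !tactE !comp_lfunE amulrE antipodeM rmorphM mulrA.
rewrite trace_trot -comp_lfunA trace_comm; congr trace.
apply/lfunP => z; rewrite !comp_lfunE !amulrE.
by rewrite !mulrA.
Qed.

Lemma trace_twist n :
  trace (spower (twist_comul_ahom cF) n \o SF)%VF =
  trace (spower comul n \o S)%VF.
Proof.
have -> : (spower (twist_comul_ahom cF) n \o SF)%VF =
    (amulr 1 \o tmults H n \o (DF n \o SF))%VF.
  by apply/lfunP => x; rewrite !comp_lfunE amulrE mulr1.
rewrite -trace_trot.
(* Splitting off [twist_fac F n] lets it cycle around the trace, leaving the conjugate computed by
   [trot_twist]. *)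
have -> : trot (DF n \o SF) 1 =
  (amull (twist_fac F n) \o
     (amull (twist_fac_inv F n) \o trot (DF n \o SF) 1))%VF.
  apply/lfunP => z; rewrite [RHS]comp_lfunE amullE.
  by rewrite [X in _ * X]comp_lfunE amullE mulrA twist_facK // mul1r.
rewrite trace_comm.
have -> : ((amull (twist_fac_inv F n) \o trot (DF n \o SF) 1) \o
    amull (twist_fac F n))%VF = (amull (D n u) \o trot (D n \o S) w)%VF.
  apply/lfunP => z; rewrite 2![LHS]comp_lfunE [RHS]comp_lfunE !amullE.
  exact: trot_twist.
rewrite trace_mulSr mulSw_twist; congr trace.
by apply/lfunP => x; rewrite [LHS]comp_lfunE amulrE mulr1.
Qed.

End TwistedTrace.

(** * Gauge invariance of the indicators *)

Lemma spower_ahom (K : fieldType) (A A' : falgType K)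
    (c : 'AHom(A, tensor A A)) (c' : 'AHom(A', tensor A' A'))
    (f : 'AHom(A, A')) :
  (forall a, c' (f a) = tmap f f (c a)) ->
  forall n a, spower c' n (f a) = f (spower c n a).
Proof.
move=> cf; elim=> [|n IHn] a; first by rewrite !spower0 !id_lfunE.
rewrite !spowerS cf; elim/tensor_ind: (c a) => [x y|s t Hs Ht]; last first.
  by rewrite !linearD /= Hs Ht.
by rewrite !tmapE !tmultE !id_lfunE IHn rmorphM.
Qed.

(** The shift by two arises because ν_(n+2) uses P_(n+1), which is [spower] at n. *)
Lemma indicatorE (K : fieldType) (H : hopfAlgType K) n :
  indicator H n.+2 = trace (spower (@comul K H) n \o antipode)%VF.
Proof. by rewrite spower_antipode -sweedler_spower. Qed.

(** Here S P_0 = ε(-)1 has rank one and trace ε(1). As P_0 is not a value of [spower], this case is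
    separate. *)
Lemma indicator1 (K : fieldType) (H : hopfAlgType K) : indicator H 1 = 1.
Proof.
rewrite -[LHS]/(trace _) (trace_rank1 (xi := @counit K H) (d := 1)).
  by rewrite rmorph1.
by move=> z; rewrite [LHS]comp_lfunE sweedler_power0 linearZ /= antipode1.
Qed.

Lemma indicator_gauge (K : fieldType) (H H' : hopfAlgType K) :
  gauge_equivalent H H' ->
  forall n, (0 < n)%N -> indicator H' n = indicator H n.
Proof.
move=> [F [cF [f [bf cf ef]]]] [|[|n]] // _; first by rewrite !indicator1.
rewrite !indicatorE.
(* The twist has the algebra structure of H, so [f] is also an algebra map into H. *)
pose g : 'AHom(H', H) := f.
have kg : lker g == 0%VS by apply/lker0P; exact: bij_inj bf.
(* The antipode of H' transported along [g] satisfies the right antipode axiom for the twisted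
   comultiplication. *)
pose SF : 'End(H) := (g \o antipode \o g^-1)%VF.
have SFg a : SF (g a) = g (antipode a).
  by rewrite 2!comp_lfunE lker0_lfunK.
have cg a : twist_comul_ahom cF (g a) = tmap g g (comul a) by exact: cf.
rewrite -(@trace_twist _ _ _ cF SF) => [|h]; last first.
  have [fi _ fiK] := bf; rewrite -(fiK h) -[f _]/(g (fi h)).
  rewrite (_ : twist_comul F _ = tmap g g (comul (fi h))); last exact: cg.
  rewrite (_ : counit (g (fi h)) = counit (fi h)); last exact: ef.
  have -> t : tmult H (tmap \1 SF (tmap g g t)) =
      g (tmult H' (tmap \1 antipode t)).
    elim/tensor_ind: t => [x y|s t Hs Ht]; last by rewrite !linearD /= Hs Ht.
    by rewrite !tmapE !tmultE !id_lfunE SFg rmorphM.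
  by rewrite antipoder linearZ /= rmorph1.
rewrite [(_ \o SF)%VF]comp_lfunA [RHS]trace_comm; congr trace.
apply/lfunP => x; rewrite [LHS]comp_lfunE [RHS]comp_lfunE.
rewrite [X in _ = _ X]comp_lfunE [X in _ = _ (_ X)]comp_lfunE.
by rewrite (spower_ahom cg) lker0_lfunK.
Qed.

(** * Existence and uniqueness of minimal polynomials *)

Section LinearRecursion.
Variables (K : fieldType).
Implicit Types (a b : nat -> K) (f p q : {poly K}).

(** A common bound m lets polynomials of different sizes be combined termwise. *)
Lemma satisfiesE a f m : (size f <= m)%N ->
  satisfies a f <->
  forall n, (0 < n)%N -> \sum_(i < m) f`_i * a (n + i)%N = 0.
Proof.
move=> fm; have e n : \sum_(i < m) f`_i * a (n + i)%N =
    \sum_(i < size f) f`_i * a (n + i)%N.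
  rewrite (big_ord_widen _ (fun i => f`_i * a (n + i)%N) fm).
  rewrite [LHS](bigID (fun i : 'I__ => i < size f)%N) /=.
  rewrite [X in _ + X]big1 ?addr0 // => i; rewrite -leqNgt => fi.
  by rewrite nth_default // mul0r.
by split=> sf n n0; [rewrite e | rewrite -e]; apply: sf.
Qed.

Lemma satisfiesZ a c f : satisfies a f -> satisfies a (c *: f).
Proof.
move=> sf; apply/(satisfiesE _ (size_scale_leq c f)) => n n0.
under eq_bigr do rewrite coefZ -mulrA.
by rewrite -mulr_sumr sf // mulr0.
Qed.

Lemma satisfiesB a p q : satisfies a p -> satisfies a q -> satisfies a (p - q).
Proof.
pose m := maxn (size p) (size q).
move=> /(satisfiesE _ (leq_maxl _ _ : size p <= m)%N) sp.
move=> /(satisfiesE _ (leq_maxr _ _ : size q <= m)%N) sq.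
have le : (size (p - q)%R <= m)%N.
  by rewrite (leq_trans (size_polyD _ _)) ?size_polyN.
apply/(satisfiesE _ le) => n n0.
under eq_bigr do rewrite coefB mulrBl.
by rewrite sumrB sp // sq // subrr.
Qed.

Lemma eq_minimal_poly a b p :
  (forall n, (0 < n)%N -> a n = b n) ->
  is_minimal_poly a p -> is_minimal_poly b p.
Proof.
have sat a' b' f : (forall n, (0 < n)%N -> a' n = b' n) ->
    satisfies a' f -> satisfies b' f.
  move=> e sf n n0; rewrite -[RHS](sf n n0); apply: eq_bigr => i _.
  by rewrite e // addn_gt0 n0.
move=> e [mp sp minp]; split=> // [|q mq sq]; first exact: sat sp.
by apply: minp => //; apply: sat sq => n n0; rewrite e.
Qed.

Lemma monic_scale f : f != 0 -> (lead_coef f)^-1 *: f \is monic.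
Proof.
by move=> f0; rewrite monicE lead_coefZ mulVf // lead_coef_eq0.
Qed.

(** Both have the same size and leading coefficient 1, so a nonzero p - q would have smaller size;
    made monic, it would contradict minimality. *)
Lemma minimal_poly_uniq a p q :
  is_minimal_poly a p -> is_minimal_poly a q -> p = q.
Proof.
move=> [mp sp minp] [mq sq minq]; apply/eqP; rewrite -subr_eq0.
have spq : size p = size q.
  by apply/eqP; rewrite eqn_leq minp ?minq.
apply: contraT => r0.
have := minp _ (monic_scale r0) (satisfiesZ _ (satisfiesB sp sq)).
rewrite size_scale ?invr_eq0 ?lead_coef_eq0 // leqNgt => /negP[].
rewrite ltnNge; apply/negP => le.
have : (p - q)`_(size p).-1 = 0.
  rewrite coefB {2}spq -!/(lead_coef _).
  by rewrite (monicP mp) (monicP mq) subrr.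
have e : size (p - q) = size p.
  apply/eqP; rewrite eqn_leq le andbT.
  by rewrite (leq_trans (size_polyD _ _)) // size_polyN -spq maxnn.
by move/eqP; rewrite -e -/(lead_coef _) lead_coef_eq0 (negPf r0).
Qed.

Lemma minimal_poly_exists a f : f != 0 -> satisfies a f ->
  exists2 p, is_minimal_poly a p & (size p <= size f)%N.
Proof.
have [n] := ubnP (size f); elim: n f => // n IHn f le_n f0 sf.
(* Whether a shorter monic polynomial is satisfied is not decidable in general, hence the classical
   case split. *)
have [[q [mq sq lt]]|nq] := classic (exists q,
    [/\ q \is monic, satisfies a q & (size q < size f)%N]).
  have [|p mp le] := IHn q _ (monic_neq0 mq) sq; first exact: leq_trans lt _.
  by exists p => //; apply: leq_trans le (ltnW lt).
have sZ : size ((lead_coef f)^-1 *: f) = size f.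
  by rewrite size_scale // invr_eq0 lead_coef_eq0.
exists ((lead_coef f)^-1 *: f); last by rewrite sZ.
split=> [||q mq sq]; [exact: monic_scale | exact: satisfiesZ |].
by rewrite sZ leqNgt; apply/negP => lt; apply: nq; exists q.
Qed.

End LinearRecursion.

Lemma linear_dependence (K : fieldType) (V : vectType K) n (x : 'I_n -> V) :
  (dim V < n)%N ->
  exists2 c : 'I_n -> K, \sum_i c i *: x i = 0 & exists i, c i != 0.
Proof.
move=> lt; pose X := [tuple x i | i < n].
have nf : ~~ free X.
  apply/negP => /eqP e.
  by have := dimvS (subvf <<X>>); rewrite e size_tuple dimvf leqNgt lt.
apply: NNPP => nc; case/negP: nf; apply/freeP => c c0 i.
apply/eqP; apply: contraT => ci; case: nc; exists c; last by exists i.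
by rewrite -[RHS]c0; apply: eq_bigr => j _; rewrite -tnth_nth tnth_mktuple.
Qed.

(** * The recursion satisfied by the indicators *)

Section IndicatorRecursion.
Variables (K : fieldType) (H : hopfAlgType K).

Lemma sweedler_powerS n :
  sweedler_power H n.+1 = conv \1 (sweedler_power H n).
Proof.
case: n => [|n]; first by rewrite conv1r sweedler_spower spower0.
by rewrite !sweedler_spower spower_conv.
Qed.

Lemma conv_linear_r (f : 'End(H)) : linear (conv f : 'End(H) -> 'End(H)).
Proof.
move=> c g h; apply/lfunP => x; rewrite add_lfunE scale_lfunE !convE.
elim/tensor_ind: (comul x) => [a b|s t Hs Ht]; last first.
  by rewrite !linearD /= Hs Ht addrACA.
by rewrite !tmapE !tmultE add_lfunE scale_lfunE mulrDr -scalerAr.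
Qed.
HB.instance Definition _ (f : 'End(H)) :=
  GRing.isSemilinear.Build K 'End(H) 'End(H) _ (conv f)
    (GRing.semilinear_linear (conv_linear_r f)).

Definition antipode_trace (g : 'End(H)) : K := trace (antipode \o g)%VF.

Lemma antipode_trace_linear : linear_for *%R antipode_trace.
Proof.
by move=> a f g; rewrite /antipode_trace comp_lfunDr -comp_lfunZr linearP.
Qed.
HB.instance Definition _ := GRing.isSemilinear.Build K 'End(H) K *%R
  antipode_trace (GRing.semilinear_linear antipode_trace_linear).

Lemma indicator_satisfies : exists f : {poly K},
  [/\ f != 0, satisfies (indicator H) f & ((size f).-1 <= (\dim {:H}) ^ 2)%N].
Proof.
set d := (\dim {:H} ^ 2)%N.
have dE : (dim 'End(H) < d.+1)%N by rewrite ltnS /d dimvf -mulnn.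
have [c c0 [i0 ci0]] := linear_dependence (fun i => sweedler_power H i) dE.
pose f := \poly_(i < d.+1) (if insub i is Some j then c j else 0).
have fE (i : 'I_d.+1) : f`_i = c i by rewrite coef_poly ltn_ord valK.
have sf : (size f <= d.+1)%N by exact: size_poly.
exists f; split.
- by apply: contraNneq ci0 => f0; rewrite -fE f0 coef0.
- apply/(satisfiesE _ sf) => [[//|n]] _.
  (* Convolving a dependence with the identity on the left raises every index by one. *)
  have ck k : \sum_i c i *: sweedler_power H (k + i) = 0.
    elim: k => [|k IHk]; first exact: c0.
    transitivity (conv \1 (\sum_i c i *: sweedler_power H (k + i))).
      rewrite linear_sum; apply: eq_bigr => i _.
      by rewrite addSn sweedler_powerS linearZ.
    by rewrite IHk linear0.
  (* Since ν_(n+1+i) = Tr(S P_(n+i)), the recursion from index 1 on matches the dependences from P_0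
     on. *)
  transitivity (antipode_trace (\sum_i c i *: sweedler_power H (n + i))).
    by rewrite linear_sum; apply: eq_bigr => i _; rewrite fE linearZ.
  by rewrite ck linear0.
by case: (size f) sf.
Qed.

End IndicatorRecursion.

Theorem proposition2p7 (K : fieldType) (H : hopfAlgType K) :
  linearly_recursive (indicator H) /\
  exists p : {poly K},
    [/\ unique (is_minimal_poly (indicator H)) p,
        ((size p).-1 <= (\dim {:H}) ^ 2)%N &
        forall H' : hopfAlgType K, gauge_equivalent H H' ->
          unique (is_minimal_poly (indicator H')) p].
Proof.
have [f [f0 sf le_f]] := indicator_satisfies H.
split; first by exists f.
have [p mp le_p] := minimal_poly_exists f0 sf.
exists p; split=> [||H' gH].
- by split=> // q; exact: minimal_poly_uniq.
- by apply: leq_trans le_f; rewrite -!subn1 leq_sub2r.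
have mp' : is_minimal_poly (indicator H') p.
  by apply: eq_minimal_poly mp => n n0; rewrite (indicator_gauge gH).
by split=> // q; exact: minimal_poly_uniq.
Qed.
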